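(* Let $T$ be a semi-complete digraph. Then every outdegree ordering of $V(T)$ has width at most $m(\mathbf{ctw}(T))$, where $m(t)=100t^2+22t+1$.
   Context: All digraphs are simple (no loops, no multiple arcs). A digraph $T$ is semi-complete if for every two distinct vertices $v,w$ at least one of the arcs $(v,w)$, $(w,v)$ is present (both may be present). $d^+(v)$ denotes the outdegree of $v$. An outdegree ordering of $V(T)$ is an ordering of the vertices by nondecreasing outdegree. For an ordering $\pi$ of $V=V(T)$, let $\pi[\alpha]$ be the set of the first $\alpha$ vertices; for $X,Y\subseteq V$, $E(X,Y)$ is the set of arcs $(x,y)$ with $x\in X$, $y\in Y$. The width of $\pi$ is $\max_{0\le\alpha\le|V|}|E(\pi[\alpha],V\setminus\pi[\alpha])|$, and the cutwidth $\mathbf{ctw}(T)$ is the minimum width over all orderings of $V$. *)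

(* Defs.v *)
From mathcomp Require Import all_boot.

Set Implicit Arguments.
Unset Strict Implicit.
Unset Printing Implicit Defensive.

(* A simple digraph on the vertex set V is an irreflexive relation T : rel V,
   with T v w meaning that the arc (v, w) is present. Nothing forbids both
   (v, w) and (w, v). *)

Section Digraph.

Variables (V : finType) (T : rel V).

Definition semi_complete : Prop :=
  forall v w : V, v != w -> T v w || T w v.

Definition outdeg (v : V) : nat := #|[set w | T v w]|.

Definition arcs (X Y : {set V}) : {set V * V} :=
  [set xy in setX X Y | T xy.1 xy.2].

(* Orderings of V are lists of all vertices without repetition, kept as
   #|V|-tuples so that they range over a finite type. *)
Definition is_ordering (s : #|V|.-tuple V) : bool := perm_eq s (enum V).

Definition outdegree_ordering (s : #|V|.-tuple V) : bool :=
  is_ordering s && sorted (fun v w => outdeg v <= outdeg w) s.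

Definition prefix_set (s : #|V|.-tuple V) (a : nat) : {set V} :=
  [set v in take a s].

Definition width (s : #|V|.-tuple V) : nat :=
  \max_(a < #|V|.+1) #|arcs (prefix_set s a) (~: prefix_set s a)|.

(* enum_tuple V is only the starting point required by arg min; it is an
   ordering (enum_is_ordering), so the minimum is over a nonempty set. *)
Definition ctw : nat :=
  width [arg min_(s < enum_tuple V | is_ordering s) width s].

End Digraph.

Lemma enum_is_ordering (V : finType) : is_ordering (enum_tuple V).
Proof. exact: perm_refl. Qed.

Lemma ctwP (V : finType) (T : rel V) :
  (exists2 s, is_ordering s & width T s = ctw T) /\
  (forall s, is_ordering s -> ctw T <= width T s).
Proof.
rewrite /ctw; case: arg_minnP => [|s os mins]; first exact: enum_is_ordering.
by split; [exists s | exact: mins].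
Qed.

Definition m (t : nat) : nat := 100 * t ^ 2 + 22 * t + 1.

(* Main.v *)
Require Import Defs.
From mathcomp Require Import all_boot zify.

(* Let s have width t and let p be the position in s. At most p(v) out-neighbours
   of v precede it, at most t follow it, and by semi-completeness all but t of its
   predecessors are out-neighbours, so |outdeg(v) - p(v)| <= t. Hence, if A is a
   prefix of an outdegree ordering, p(v) <= p(w) + 2t for v in A and w outside A.
   Taking v in A last in s and w outside A first in s, an arc leaving A crosses the
   cut of s just before w, or the one just after v, or has both ends among the
   at most 2t + 1 vertices from w to v; the width is thus at most 2t + (2t + 1)^2. *)

Set Implicit Arguments.
Unset Strict Implicit.
Unset Printing Implicit Defensive.

Lemma in_arcs (V : finType) (T : rel V) (X Y : {set V}) x y :
  ((x, y) \in arcs T X Y) = [&& x \in X, y \in Y & T x y].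
Proof. by rewrite inE in_setX andbA. Qed.

Section Ordering.

Variables (V : finType) (T : rel V) (s : #|V|.-tuple V).
Hypothesis s_ord : is_ordering s.

Lemma mem_ordering v : v \in s.
Proof. by rewrite (perm_mem s_ord) mem_enum. Qed.

Lemma index_ordering v : index v s < #|V|.
Proof. by rewrite -{2}(size_tuple s) index_mem mem_ordering. Qed.

Lemma in_prefix_set v a : (v \in prefix_set s a) = (index v s < a).
Proof. by rewrite inE in_take // mem_ordering. Qed.

Lemma card_prefix_set a : a <= #|V| -> #|prefix_set s a| = a.
Proof.
move=> le_a; have uniq_s : uniq s by rewrite (perm_uniq s_ord) enum_uniq.
by rewrite cardsE (card_uniqP (take_uniq a uniq_s)) size_takel // size_tuple.
Qed.

Lemma cut_le_width a : a <= #|V| ->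
  #|arcs T (prefix_set s a) (~: prefix_set s a)| <= width T s.
Proof.
rewrite -ltnS => lt_a.
exact: (leq_bigmax (F := fun a : 'I_#|V|.+1 =>
  #|arcs T (prefix_set s a) (~: prefix_set s a)|) (Ordinal lt_a)).
Qed.

Lemma outdeg_le_index v : irreflexive T ->
  outdeg T v <= index v s + width T s.
Proof.
move=> irrT; have lt_v := index_ordering v.
rewrite -{1}(card_prefix_set (ltnW lt_v)).
apply: leq_trans (leq_add (leqnn _) (cut_le_width lt_v)).
rewrite /outdeg -(cardsID (prefix_set s (index v s)) [set w | T v w]).
apply: leq_add; first exact/subset_leq_card/subsetIr.
(* The out-neighbours [w] outside the prefix are counted by their arcs [(v, w)]. As [v] has no loop,
   [w] lies strictly after [v], so these arcs cross the cut just after [v]. *)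
have pairv_inj : injective (pair v : V -> V * V) by move=> ? ? [].
rewrite -(card_imset _ pairv_inj).
apply/subset_leq_card/subsetP => _ /imsetP[w + ->].
rewrite !(in_arcs, in_setD, in_setC, in_prefix_set, inE) -!leqNgt.
case/andP=> le_vw Tvw; rewrite Tvw ltnSn andbT /= ltn_neqAle le_vw andbT.
apply: contraTneq Tvw => /index_inj eq_vw.
by rewrite -(eq_vw v) ?mem_ordering // irrT.
Qed.

Lemma index_le_outdeg v : semi_complete T ->
  index v s <= outdeg T v + width T s.
Proof.
move=> scT; have le_v := ltnW (index_ordering v).
rewrite -{1}(card_prefix_set le_v).
apply: leq_trans (leq_add (leqnn _) (cut_le_width le_v)).
rewrite -(cardsID [set w | T v w] (prefix_set s (index v s))).
apply: leq_add; first exact/subset_leq_card/subsetIr.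
(* A predecessor [u] that is not an out-neighbour of [v] must send an arc to [v]; the arcs [(u, v)]
   cross the cut just before [v]. *)
have pairv_inj : injective (fun u : V => (u, v)) by move=> ? ? [].
rewrite -(card_imset _ pairv_inj).
apply/subset_leq_card/subsetP => _ /imsetP[u + ->].
rewrite !(in_arcs, in_setD, in_setC, in_prefix_set, inE) ltnn.
case/andP=> NTvu lt_uv; rewrite lt_uv /=.
have /scT : u != v by apply: contraTneq lt_uv => ->; rewrite ltnn.
by rewrite (negPf NTvu) orbF.
Qed.

Lemma card_arcs_almost_prefix (A : {set V}) d :
  (forall v w, v \in A -> w \notin A -> index v s <= index w s + d) ->
  #|arcs T A (~: A)| <= 2 * width T s + d.+1 ^ 2.
Proof.
(* An arc leaving [A] provides the members of [A] and of its complement that the extremal choices of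
   [v] and [w] require. *)
move=> leA; have [->|[[x0 y0]]] := set_0Vmem (arcs T A (~: A)).
  by rewrite cards0.
rewrite in_arcs in_setC => /and3P[x0A y0A _].
case: (arg_maxnP (fun v => index v s) x0A) => v vA max_v.
case: (arg_minnP (P := [pred w | w \notin A]) (fun w => index w s) y0A).
move=> w wA min_w; set P := prefix_set s (index w s).
set Q := prefix_set s (index v s).+1.
(* [Q :\: P] is the interval of [s] from [w] to [v], both included, hence the [+1]; it is empty if
   [v] precedes [w]. *)
have cardM : #|Q :\: P| <= d.+1.
  have [lt_vw | le_wv] := ltnP (index v s) (index w s).
    have /eqP-> : Q :\: P == set0; last by rewrite cards0.
    rewrite setD_eq0; apply/subsetP=> z; rewrite !in_prefix_set; lia.
  have subPQ : P \subset Q.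
    by apply/subsetP=> z; rewrite !in_prefix_set; lia.
  have := leA v w vA wA; rewrite cardsD (setIidPr subPQ).
  have lt_v := index_ordering v; have /ltnW le_w := index_ordering w.
  by rewrite !card_prefix_set //; lia.
have cutP : #|arcs T P (~: P)| <= width T s.
  exact/cut_le_width/ltnW/index_ordering.
have cutQ : #|arcs T Q (~: Q)| <= width T s by exact/cut_le_width/index_ordering.
(* By extremality [x] is in [Q] and [y] is not in [P]. If [x] is in [P] or [y] is outside [Q], the
   arc crosses that cut; otherwise both ends lie in [Q :\: P]. *)
have sub : arcs T A (~: A) \subset
    arcs T P (~: P) :|: arcs T Q (~: Q) :|: setX (Q :\: P) (Q :\: P).
  apply/subsetP=> -[x y].
  rewrite !(in_setU, in_setX, in_arcs, in_setD, in_setC, in_prefix_set) /=.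
  case/and3P=> xA yA ->; have := max_v x xA; have := min_w y yA.
  rewrite /geq /=; lia.
apply: leq_trans (subset_leq_card sub) _.
rewrite mul2n -addnn; apply: leq_trans (leq_card_setU _ _) _.
apply: leq_add; last by rewrite cardsX leq_mul.
by apply: leq_trans (leq_card_setU _ _) _; apply: leq_add.
Qed.

End Ordering.

Lemma outdeg_prefix_set (V : finType) (T : rel V) (s : #|V|.-tuple V) a v w :
  outdegree_ordering T s -> v \in prefix_set s a -> w \notin prefix_set s a ->
  outdeg T v <= outdeg T w.
Proof.
case/andP=> s_ord sorted_s; rewrite !in_prefix_set // -leqNgt => lt_va le_aw.
apply: (sorted_leq_index _ _ sorted_s); rewrite ?mem_ordering //.
- by move=> y x z; apply: leq_trans.
- exact: leq_trans (ltnW lt_va) le_aw.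
Qed.

Theorem theorem18 (V : finType) (T : rel V)
    (simpleT : irreflexive T) (scT : semi_complete T)
    (s : #|V|.-tuple V) (outdeg_s : outdegree_ordering T s) :
  width T s <= m (ctw T).
Proof.
have [[r r_ord <-] _] := ctwP T; set t := width T r.
(* Here [d = 2 * t], one [t] for each passage between outdegree and position; the bound equals
   [4 * t ^ 2 + 6 * t + 1]. *)
apply: (@leq_trans (2 * t + (2 * t).+1 ^ 2)); last by rewrite /m; nia.
apply/bigmax_leqP => a _; apply: card_arcs_almost_prefix => // v w vA wA.
have := outdeg_prefix_set outdeg_s vA wA.
have := index_le_outdeg r_ord v scT; have := outdeg_le_index r_ord w simpleT.
rewrite -/t; lia.
Qed.
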